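(* For any $\rho>0$, if the NIPT thresholds satisfy $c_n^D=0$ for all $n\leq(1+\rho)\frac{c^S}{\underline{q}}$, then \[ WADD(t_I)\leq (1+o(1))\frac{2c^S}{\underline{q}} \] as $c^S\to\infty$ and $\rho\to0$, where $\underline{q}=\min_j\underline{q}_j-\kappa$.
   Context: Sensor network model: there are $J$ sensors. Sensor $j\in[J]=\{1,\dots,J\}$ has a finite alphabet $\mathcal{A}_j$ with $m_j$ letters; $\mathcal{P}_j$ is the simplex of pmfs on $\mathcal{A}_j$ with the $\ell_1$ norm. Sensor $j$ observes $X_{j,k}$, $k=1,2,\dots$; write $X_k=(X_{1,k},\dots,X_{J,k})$ and $X_l^k=(X_l,\dots,X_k)$. There is a known pre-change pmf $f_{j,0}\in\mathcal{P}_j$, an unknown change point $t_1\in\{1,2,\dots\}\cup\{\infty\}$, an unknown nonempty set $\mathcal{J}\subseteq[J]$ of affected sensors and unknown post-change pmfs $f_{j,1}$. For $k<t_1$ the vectors $X_k$ are i.i.d. with joint pmf $f_0=\otimes_j f_{j,0}$; for $k\ge t_1$ they are i.i.d. (independent of the past) with joint pmf $\otimes_j\tilde f_j$ where $\tilde f_j=f_{j,1}$ if $j\in\mathcal{J}$ and $\tilde f_j=f_{j,0}$ otherwise. $P_{f_1,\mathcal{J},t_1}$, $E_{f_1,\mathcal{J},t_1}$ denote the corresponding law and expectation. For each $j$ there is a concave statistic $q_j:\mathcal{P}_j\to\mathbb{R}$, Lipschitz with constant $L_j$ w.r.t. $\ell_1$, with $q_j(f_{j,0})=0$ and $q_j(f_{j,1})\ge\underline{q}_j>0$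 (the admissible post-change pmfs are those with $q_j(f_{j,1})\ge\underline q_j$). Let $\mathcal{A}=\times_j\mathcal{A}_j$, $\mathcal{P}$ the simplex of pmfs on $\mathcal{A}$, and $q(f)=\sum_j q_j(f_j)$ where $f_j$ is the $j$-th marginal of $f\in\mathcal{P}$. $\hat f_{X_l^k}\in\mathcal{P}$ is the empirical pmf of $X_l,\dots,X_k$. $I(f\|g)=\sum_a f(a)\log\frac{f(a)}{g(a)}$ is the KL divergence. Network information projection test (NIPT): fix $0<\kappa<\min_j\underline{q}_j$, a threshold $c^S>0$ and thresholds $c_n^D\ge 0$, $n\ge1$. For $n\ge1$ let $f_n^*=\arg\min\{I(f\|f_0): f\in\mathcal{P},\,q(f)\ge c^S/n+\kappa\}$. Set $\tau_1=1$ and for $k\ge1$: $S_k=\max_{\tau_k\le l\le k+1}(k-l+1)\big(q(\hat f_{X_l^k})-\kappa\big)$ (the term $l=k+1$ equals $0$), $i_k$ the maximizing $l$, $n_k=k-i_k+1$, $D_k=I(\hat f_{X_{i_k}^k}\|f^*_{n_k})$, and $\tau_{k+1}=k+1$ if $S_k\ge c^S$ and $D_k<c^D_{n_k}$, else $\tau_{k+1}=\tau_k$. Define $t_S=\inf\{k: S_k\ge c^S\}$ and $t_I=\inf\{k: S_k\ge c^S\text{ and }D_k\ge c^D_{n_k}\}$. The worst average detection delay of a stopping time $t$ is $WADD(t)=\sup_{f_1,\mathcal{J},t_1}\operatorname{ess\,sup}_{X_1^{t_1-1}}E_{f_1,\mathcal{J},t_1}\big((t-t_1+1)^+\mid X_1^{t_1-1}\big)$,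 the supremum being over admissible post-change pmfs, nonempty $\mathcal{J}$ and finite $t_1\ge1$. *)

(* Defs.v *)
From HB Require Import structures.
From mathcomp Require Import all_boot all_order all_algebra.
From mathcomp Require Import all_classical all_reals all_analysis.
Set Implicit Arguments. Unset Strict Implicit. Unset Printing Implicit Defensive.
Import Order.TTheory GRing.Theory Num.Theory.
Local Open Scope ring_scope.

Section Generic.
Variable R : realType.

Definition is_pmf (T : finType) (f : {ffun T -> R}) : Prop :=
  (forall a, 0 <= f a) /\ \sum_a f a = 1.

Definition l1dist (T : finType) (f g : {ffun T -> R}) : R := \sum_a `|f a - g a|.

Definition KL (T : finType) (f g : {ffun T -> R}) : \bar R :=
  if [exists a, (0 < f a) && (g a == 0)] then +oo%E
  else (\sum_(a | 0 < f a) f a * ln (f a / g a))%:E.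

Definition concave_on_simplex (T : finType) (q : {ffun T -> R} -> R) : Prop :=
  forall f g (lam : R), is_pmf f -> is_pmf g -> 0 <= lam <= 1 ->
    lam * q f + (1 - lam) * q g <= q (lam *: f + (1 - lam) *: g).

Definition lipschitz_on_simplex (T : finType) (q : {ffun T -> R} -> R) (L : R) : Prop :=
  forall f g, is_pmf f -> is_pmf g -> `|q f - q g| <= L * l1dist f g.

End Generic.

Section Network.
Variable R : realType.
Variable J : nat.
Variable A : 'I_J -> finType.

Local Notation Xt := {dffun forall j : 'I_J, A j}.

Definition marg (j : 'I_J) (f : {ffun Xt -> R}) : {ffun A j -> R} :=
  [ffun a => \sum_(x : Xt | x j == a) f x].

Definition prodpmf (g : forall j : 'I_J, {ffun A j -> R}) : {ffun Xt -> R} :=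
  [ffun x : Xt => \prod_(j < J) g j (x j)].

Definition qtot (q : forall j : 'I_J, {ffun A j -> R} -> R) (f : {ffun Xt -> R}) : R :=
  \sum_(j < J) q j (marg j f).

(* Observation sequences: a word w = [:: X_1; X_2; ...]; obs w i = X_i (i >= 1) *)
Definition obs (w : seq Xt) (i : nat) : option Xt := nth None (map Some w) i.-1.

Definition emp (w : seq Xt) (l k : nat) : {ffun Xt -> R} :=
  [ffun a => (\sum_(l <= i < k.+1) ((obs w i == Some a) : nat)%:R) / (k.+1 - l)%:R].

Section NIPT.
Variable q : forall j : 'I_J, {ffun A j -> R} -> R.
Variables (kappa cS : R) (cD : nat -> R) (fstar : nat -> {ffun Xt -> R}).
Variable f0 : forall j : 'I_J, {ffun A j -> R}.

(* (k-l+1)(q(\hat f_{X_l^k}) - kappa); equals 0 for l = k+1 *)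
Definition Wterm (w : seq Xt) (k l : nat) : R :=
  (k.+1 - l)%:R * (qtot q (emp w l k) - kappa).

(* S_k given tau_k = t *)
Definition Sk (w : seq Xt) (k t : nat) : R :=
  \big[Num.max/0]_(t <= l < k.+2) Wterm w k l.

Definition ik (w : seq Xt) (k t : nat) : nat :=
  head k.+1 [seq l <- index_iota t k.+2 | Wterm w k l == Sk w k t].

Definition nk (w : seq Xt) (k t : nat) : nat := k.+1 - ik w k t.

Definition Dk (w : seq Xt) (k t : nat) : \bar R :=
  KL (emp w (ik w k t) k) (fstar (nk w k t)).

Definition reset (w : seq Xt) (k t : nat) : bool :=
  (cS <= Sk w k t) && (Dk w k t < (cD (nk w k t))%:E)%E.

(* tau w k = tau_k  (k >= 1);  tau_1 = 1 *)
Fixpoint tau (w : seq Xt) (k : nat) : nat :=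
  match k with
  | 0 => 1
  | k'.+1 => if (0 < k')%N && reset w k' (tau w k') then k'.+1 else tau w k'
  end.

Definition S_at (w : seq Xt) (k : nat) : R := Sk w k (tau w k).

Definition stopI (w : seq Xt) (k : nat) : bool :=
  (cS <= S_at w k) &&
  ((cD (nk w k (tau w k)))%:E <= Dk w k (tau w k))%E.

End NIPT.

Definition feasible (q : forall j : 'I_J, {ffun A j -> R} -> R) (kappa cS : R) (n : nat)
  (f : {ffun Xt -> R}) : Prop :=
  is_pmf f /\ cS / n%:R + kappa <= qtot q f.

Definition is_fstar (q : forall j : 'I_J, {ffun A j -> R} -> R) (kappa cS : R)
  (f0 : forall j : 'I_J, {ffun A j -> R}) (fstar : nat -> {ffun Xt -> R}) : Prop :=
  forall n : nat, (0 < n)%N -> (exists f, feasible q kappa cS n f) ->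
    feasible q kappa cS n (fstar n) /\
    forall f, feasible q kappa cS n f -> (KL (fstar n) (prodpmf f0) <= KL f (prodpmf f0))%E.

(* P(t >= t1 + m | X_1^{t1-1} = u) where after the change the X's are iid g,
   and st w k = "the stopping condition holds at time k" *)
Definition Pnostop (g : {ffun Xt -> R}) (st : seq Xt -> nat -> bool) (u : seq Xt) (m : nat) : R :=
  \sum_(v : m.-tuple Xt)
     (\prod_(i < m) g (tnth v i)) *
     ([forall k : 'I_(size u + m).+1, (0 < val k)%N ==> ~~ st (u ++ v) k] : nat)%:R.

(* E((t - t1 + 1)^+ | X_1^{t1-1} = u) = sum_{m >= 0} P(t >= t1 + m | u) *)
Definition cdelay (g : {ffun Xt -> R}) (st : seq Xt -> nat -> bool) (u : seq Xt) : \bar R :=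
  (\sum_(0 <= m <oo) (Pnostop g st u m)%:E)%E.

Definition postpmf (f0 f1 : forall j : 'I_J, {ffun A j -> R}) (JJ : {set 'I_J}) : {ffun Xt -> R} :=
  prodpmf (fun j => if j \in JJ then f1 j else f0 j).

Definition Ppast (f0 : forall j : 'I_J, {ffun A j -> R}) (u : seq Xt) : R :=
  \prod_(x <- u) prodpmf f0 x.

(* WADD: sup over admissible post-change pmfs, nonempty affected sets, finite
   change points t1 = size u + 1 >= 1, and ess sup over pasts u (positive probability) *)
Definition WADD (q : forall j : 'I_J, {ffun A j -> R} -> R) (qlow : 'I_J -> R)
  (f0 : forall j : 'I_J, {ffun A j -> R}) (st : seq Xt -> nat -> bool) : \bar R :=
  ereal_sup [set d | exists (f1 : forall j : 'I_J, {ffun A j -> R}) (JJ : {set 'I_J}) (u : seq Xt),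
     [/\ JJ != finset.set0,
         (forall j, j \in JJ -> is_pmf (f1 j) /\ qlow j <= q j (f1 j)),
         0 < Ppast f0 u &
         d = cdelay (postpmf f0 f1 JJ) st u]].

Definition qbar (qlow : 'I_J -> R) (kappa : R) : R :=
  fine (\big[mine/+oo%E]_(j < J) (qlow j)%:E) - kappa.

End Network.

(* Main.v *)
(* Let N be an integer between (1 + rho/2) cS / qbar and (1 + rho) cS / qbar.
   If every window of N consecutive observations among 2N fresh ones has an
   empirical pmf close to the post-change pmf, its increment exceeds cS, and
   then, whatever the history, the test stops within these 2N steps: either
   the first crossing stops, or it resets the test; after the reset, the next
   crossing occurs within N steps, and there no reset is possible because
   c^D_n = 0 for n <= N while the divergence is nonnegative.
   By a fourth-moment bound and a union bound over the N + 1 windows, the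
   exceptional event has probability p = O(1/N), uniformly in the post-change
   pmf.  Hence P(delay >= m + 2N) <= p P(delay >= m) for all m, and the mean
   delay is at most 2N / (1 - p). *)
Require Import Defs.
From HB Require Import structures.
From mathcomp Require Import all_boot all_order all_algebra.
From mathcomp Require Import all_classical all_reals all_analysis.
From mathcomp Require Import ring lra zify.
Import Order.TTheory GRing.Theory Num.Theory.
Local Open Scope ring_scope.

Set Implicit Arguments. Unset Strict Implicit. Unset Printing Implicit Defensive.

(** * Expectation over i.i.d. words *)

Section Expectation.
Variables (R : realType) (T : finType) (g : {ffun T -> R}).

(** [F] takes words of any length, so that words can be extended and split without casts between
    tuple types. *)
Definition Ex m (F : seq T -> R) : R :=
  \sum_(v : m.-tuple T) (\prod_(x <- v) g x) * F v.

Lemma eq_Ex m F G : (forall v, size v = m -> F v = G v) -> Ex m F = Ex m G.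
Proof. by move=> FG; apply: eq_bigr => v _; rewrite FG ?size_tuple. Qed.

Lemma Ex0 F : Ex 0 F = F [::].
Proof.
rewrite /Ex (bigD1 [tuple]) //= big_nil mul1r big1 ?addr0 // => v.
by move=> /eqP[]; exact: tuple0.
Qed.

Lemma ExS m F : Ex m.+1 F = \sum_x g x * Ex m (fun v => F (x :: v)).
Proof.
under eq_bigr => x _ do rewrite mulr_sumr.
rewrite pair_bigA /= /Ex.
rewrite (reindex (fun p : T * m.-tuple T => cons_tuple p.1 p.2)) /=.
  by apply: eq_bigr => -[x v] _ /=; rewrite big_cons mulrA.
exists (fun v : m.+1.-tuple T => (thead v, behead_tuple v)) => [[x v] _|v _].
  by congr pair; apply: val_inj.
by rewrite [RHS]tuple_eta; apply: val_inj.
Qed.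

Lemma ExD m F G : Ex m (fun v => F v + G v) = Ex m F + Ex m G.
Proof. by rewrite /Ex -big_split; apply: eq_bigr => v _; rewrite mulrDr. Qed.

Lemma ExZ m c F : Ex m (fun v => c * F v) = c * Ex m F.
Proof. by rewrite /Ex mulr_sumr; apply: eq_bigr => v _; rewrite mulrCA. Qed.

Lemma Ex_sum (I : Type) (r : seq I) (P : pred I) m (F : I -> seq T -> R) :
  Ex m (fun v => \sum_(i <- r | P i) F i v) = \sum_(i <- r | P i) Ex m (F i).
Proof. by rewrite /Ex exchange_big; apply: eq_bigr => v _; rewrite mulr_sumr. Qed.

Lemma Ex_cat m n F :
  Ex (m + n) F = Ex m (fun u => Ex n (fun v => F (u ++ v))).
Proof.
elim: m F => [|m IH] F; first by rewrite Ex0.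
by rewrite addSn !ExS; apply: eq_bigr => x _; rewrite IH.
Qed.

Hypothesis gP : is_pmf g.

Lemma Ex_le m F G : (forall v, size v = m -> F v <= G v) -> Ex m F <= Ex m G.
Proof.
move=> FG; apply: ler_sum => v _; rewrite ler_wpM2l ?FG ?size_tuple //.
by apply: prodr_ge0 => x _; case: gP.
Qed.

Lemma Ex_cst m c : Ex m (fun=> c) = c.
Proof.
elim: m => [|m IH]; first by rewrite Ex0.
by rewrite ExS; under eq_bigr do rewrite IH; rewrite -mulr_suml gP.2 mul1r.
Qed.

Lemma pmf_le1 a : g a <= 1.
Proof. by rewrite -gP.2 (bigD1 a) //= lerDl sumr_ge0 // => ? _; case: gP. Qed.

Lemma ler_mean (Y : T -> R) c : (forall x, Y x <= c) -> \sum_x g x * Y x <= c.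
Proof.
move=> Yc; rewrite -[leRHS]mul1r -gP.2 mulr_suml; apply: ler_sum => x _.
by rewrite ler_wpM2l //; case: gP.
Qed.

(** * Moments of sums of centred bounded variables *)

Section Moments.
Variable Y : T -> R.
Hypothesis EY : \sum_x g x * Y x = 0.
Hypothesis Y1 : forall x, `|Y x| <= 1.
Let S (v : seq T) := \sum_(x <- v) Y x.

Lemma Ex_sum_centered m : Ex m S = 0.
Proof.
elim: m => [|m IH]; first by rewrite Ex0 /S big_nil.
rewrite ExS -[RHS]EY; apply: eq_bigr => x _; congr (_ * _).
rewrite (_ : (fun v => _) = (fun v => Y x + S v)).
  by rewrite ExD Ex_cst IH addr0.
by apply/funext => v; rewrite /S big_cons.
Qed.

Lemma Ex_sum_sqr m : Ex m (fun v => S v ^+ 2) <= m%:R.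
Proof.
elim: m => [|m IH]; first by rewrite Ex0 /S big_nil expr0n.
rewrite ExS; apply: (@ler_mean _ m.+1%:R) => x.
rewrite (_ : (fun v => _) = (fun v => Y x ^+ 2 + (2 * Y x * S v + S v ^+ 2))).
  rewrite ExD Ex_cst ExD ExZ Ex_sum_centered mulr0 add0r -natr1 addrC lerD //.
  by rewrite -[X in X <= _]ger0_norm ?sqr_ge0 // normrX expr_le1.
by apply/funext => v; rewrite /S big_cons; ring.
Qed.

(** Second moments would bound each window failure only by O(1/n), too weak for a union bound over n
    + 1 windows; fourth moments give O(1/n^2). *)
Lemma Ex_sum_fourth m : Ex m (fun v => S v ^+ 4) <= 3 * m%:R ^+ 2.
Proof.
elim: m => [|m IH]; first by rewrite Ex0 /S big_nil !expr0n mulr0.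
(* The term linear in the remaining sum vanishes by centring; the cubic one is kept as a multiple of
   [Y x], since it vanishes only after averaging over [x]. *)
have step x : Ex m (fun v => S (x :: v) ^+ 4) =
    4 * Ex m (fun v => S v ^+ 3) * Y x +
    (Y x ^+ 4 + 6 * Y x ^+ 2 * Ex m (fun v => S v ^+ 2)
    + Ex m (fun v => S v ^+ 4)).
  rewrite (_ : (fun v => _) = (fun v => Y x ^+ 4 + (4 * Y x ^+ 3 * S v +
     (6 * Y x ^+ 2 * S v ^+ 2 + (4 * Y x * S v ^+ 3 + S v ^+ 4))))).
    by rewrite ExD Ex_cst !ExD !ExZ Ex_sum_centered; ring.
  by apply/funext => v; rewrite /S big_cons; ring.
rewrite ExS; under eq_bigr do rewrite step mulrDr mulrCA.
rewrite big_split /= -mulr_sumr EY mulr0 add0r.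
apply: ler_mean => x.
have Y2 : Y x ^+ 2 <= 1.
  by rewrite -[X in X <= _]ger0_norm ?sqr_ge0 // normrX expr_le1.
have Y20 := sqr_ge0 (Y x).
have := Ex_sum_sqr m; have M20 : 0 <= Ex m (fun v => S v ^+ 2).
  by rewrite -[X in X <= _](Ex_cst m 0); apply: Ex_le => v _; exact: sqr_ge0.
move: IH M20; set M4 := Ex m _; set M2 := Ex m _ => M4le M20 M2le.
have -> : Y x ^+ 4 = (Y x ^+ 2) ^+ 2 by ring.
rewrite -[m.+1%:R]natr1; move: (Y x ^+ 2) Y2 Y20 => y y1 y0.
have -> : 3 * (m%:R + 1) ^+ 2 = 1 + 6 * m%:R + 3 * m%:R ^+ 2 + 2 :> R by ring.
have h1 : y ^+ 2 <= 1 by rewrite expr_le1.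
have h2 : y * M2 <= m%:R by rewrite -[leRHS]mul1r ler_pM.
lra.
Qed.

End Moments.
End Expectation.

(** * Product pmfs and divergence *)

Section ProductPmf.
Variables (R : realType) (J : nat) (A : 'I_J -> finType).
Local Notation Xt := {dffun forall j : 'I_J, A j}.

Lemma sum_prod_dffun (F : forall j : 'I_J, A j -> R) :
  \sum_(x : Xt) \prod_(j < J) F j (x j) = \prod_(j < J) \sum_(a : A j) F j a.
Proof.
(* Passing to [fprod] turns dependent functions into families of tagged letters, for which the
   product distributes over the sums. *)
pose P j : {ffun A j -> R} := [ffun a => F j a].
transitivity (\sum_(t : fprod A) \prod_(j in 'I_J) P j (t j)).
  rewrite (reindex (@dffun_of_fprod _ A)); last exact/onW_bij/dffun_of_fprod_bij.
  by apply: eq_bigr => t _; apply: eq_bigr => j _; rewrite !ffunE.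
rewrite big_fprod.
transitivity (\prod_(j < J) \sum_(a in tagged_with A j) untag 0 (P j) a).
  by rewrite bigA_distr_big_dep.
apply: eq_bigr => j _; rewrite -(big_tag (fun j a => P j a)).
by apply: eq_bigr => a _; rewrite ffunE.
Qed.

Lemma prodpmf_pmf (h : forall j : 'I_J, {ffun A j -> R}) :
  (forall j, is_pmf (h j)) -> is_pmf (prodpmf h).
Proof.
move=> hP; split=> [x|]; first by rewrite ffunE prodr_ge0 // => j _; case: (hP j).
under eq_bigr do rewrite ffunE.
by rewrite (sum_prod_dffun (fun j => h j)) big1 // => j _; case: (hP j).
Qed.

Lemma marg_prodpmf (h : forall j : 'I_J, {ffun A j -> R}) j :
  (forall j, is_pmf (h j)) -> marg j (prodpmf h) = h j.
Proof.
move=> hP; apply/ffunP => a; rewrite ffunE.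
(* The indicator of [x j = a] is absorbed into the factor at [j], so that the sum factorizes again;
   tags make letters of different alphabets comparable. *)
pose F i (b : A i) : R :=
  h i b * ((i != j) || (Tagged A b == Tagged A a))%:R.
have Fj b : F j b = h j b * (b == a)%:R by rewrite /F eqxx /= eq_Tagged.
rewrite big_mkcond; transitivity (\sum_(x : Xt) \prod_(i < J) F i (x i)).
  apply: eq_bigr => x _; rewrite ffunE.
  rewrite (bigD1 j) //= [RHS](bigD1 j) //=.
  rewrite Fj.
  rewrite [X in _ = _ * X](eq_bigr (fun i => h i (x i))).
    by case: eqP => _ /=; rewrite ?mulr1 // ?(mulr0, mul0r).
  by move=> i ij; rewrite /F ij mulr1.
rewrite sum_prod_dffun (bigD1 j) //= [X in _ * X]big1 ?mulr1.
  rewrite (bigD1 a) //= Fj eqxx mulr1 big1 ?addr0 // => b ba.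
  by rewrite Fj (negbTE ba) mulr0.
move=> i ij; rewrite -[RHS](hP i).2; apply: eq_bigr => b _.
by rewrite /F ij mulr1.
Qed.

Lemma sum_marg (f : {ffun Xt -> R}) j : \sum_a marg j f a = \sum_x f x.
Proof.
by rewrite [RHS](partition_big (fun x : Xt => x j) xpredT) //;
  apply: eq_bigr => a _; rewrite ffunE.
Qed.

Lemma marg_pmf (f : {ffun Xt -> R}) j : is_pmf f -> is_pmf (marg j f).
Proof.
move=> [f_ge0 f1]; split=> [a|]; last by rewrite sum_marg.
by rewrite ffunE sumr_ge0.
Qed.

Lemma l1dist_marg (f g : {ffun Xt -> R}) j :
  l1dist (marg j f) (marg j g) <= l1dist f g.
Proof.
rewrite /l1dist [leRHS](partition_big (fun x : Xt => x j) xpredT) //=.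
by apply: ler_sum => a _; rewrite !ffunE -sumrB ler_norm_sum.
Qed.

Lemma qtot_lipschitz (q : forall j : 'I_J, {ffun A j -> R} -> R) (L : 'I_J -> R) :
  (forall j, lipschitz_on_simplex (q j) (L j)) ->
  lipschitz_on_simplex (qtot q) (\sum_j `|L j|).
Proof.
move=> qL f g fP gP; rewrite /qtot -sumrB mulr_suml.
apply: le_trans (ler_norm_sum _ _ _) _; apply: ler_sum => j _.
apply: le_trans (qL j _ _ (marg_pmf j fP) (marg_pmf j gP)) _.
rewrite (le_trans (ler_wpM2r _ (ler_norm _))) ?ler_wpM2l ?l1dist_marg //.
by rewrite sumr_ge0.
Qed.

End ProductPmf.

(** Gibbs' inequality, from [ln y <= y - 1] at [y = g a / f a]; the intermediate sum is 1 minus the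
    [g]-mass of the support of [f]. *)
Lemma KL_ge0 (R : realType) (T : finType) (f g : {ffun T -> R}) :
  is_pmf f -> is_pmf g -> (0 <= KL f g)%E.
Proof.
move=> [f0 f1] [g0 g1]; rewrite /KL; case: ifPn => // /existsPn fg.
have pos a : 0 < f a -> 0 < g a.
  by move=> fa; have := fg a; rewrite fa /= lt_neqAle g0 andbT eq_sym.
rewrite lee_fin; apply: (@le_trans _ _ (\sum_(a | 0 < f a) (f a - g a))).
  rewrite sumrB subr_ge0.
  have -> : \sum_(a | 0 < f a) f a = 1.
    rewrite -f1 big_mkcond; apply: eq_bigr => a _; case: ltP => // fa.
    by apply/esym/eqP; rewrite eq_le fa f0.
  by rewrite -g1 big_mkcond ler_sum // => a _; case: ifP.
apply: ler_sum => a fa; have ga := pos a fa.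
rewrite -[f a / g a]invrK lnV ?posrE ?invr_gt0 ?divr_gt0 // invf_div.
have := @le_ln1Dx R (g a / f a - 1); rewrite [1 + _]addrC subrK.
rewrite ltrBrDr addNr divr_gt0 // => /(_ isT) h.
have : f a * ln (g a / f a) <= f a * (g a / f a - 1) by rewrite ler_wpM2l.
by rewrite mulrBr mulr1 mulrCA divff ?gt_eqF // mulr1 mulrN; lra.
Qed.

(** * Concentration of empirical pmfs *)

Section Empirical.
Variables (R : realType) (T : finType).

Definition empirical (v : seq T) : {ffun T -> R} :=
  [ffun a => (count_mem a v)%:R / (size v)%:R].

Lemma empirical_pmf v : (0 < size v)%N -> is_pmf (empirical v).
Proof.
move=> v0; split=> [a|]; first by rewrite ffunE divr_ge0 ?ler0n.
under eq_bigr do rewrite ffunE.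
rewrite -mulr_suml -natr_sum.
have -> : (\sum_a count_mem a v = size v)%N.
  elim: v {v0} => [|x v IH] /=; first by rewrite big1.
  rewrite big_split IH /= -add1n (bigD1 x) //= eqxx big1 //.
  by move=> a /negbTE; rewrite eq_sym => ->.
by rewrite divff // pnatr_eq0 -lt0n.
Qed.

(** Markov's inequality for the fourth power at level [n * eta / #|T|], summed over the [#|T|]
    letters; the factor 3 comes from [Ex_sum_fourth]. *)
Definition fourth_moment_const (eta : R) : R := 3 * #|T|%:R * (#|T|%:R / eta) ^+ 4.

Lemma fourth_moment_const_ge0 eta : 0 < eta -> 0 <= fourth_moment_const eta.
Proof. by move=> /ltW ?; rewrite mulr_ge0 ?exprn_ge0 ?divr_ge0 ?mulr_ge0. Qed.

Lemma Ex_l1dist_empirical (g : {ffun T -> R}) (eta : R) n :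
  is_pmf g -> 0 < eta -> (0 < n)%N ->
  Ex g n (fun v => (eta < l1dist (empirical v) g)%R%:R)
    <= fourth_moment_const eta / n%:R ^+ 2.
Proof.
move=> gP eta0 n0; have nR : 0 < n%:R :> R by rewrite ltr0n.
have T0 : 0 < #|T|%:R :> R.
  rewrite ltr0n lt0n; apply/eqP => /card0_eq T0.
  have := gP.2; rewrite big1 => [/eqP|x]; first by rewrite eq_sym oner_eq0.
  by have := T0 x; rewrite inE.
pose Y a x : R := (x == a)%:R - g a.
pose c := n%:R * eta / #|T|%:R.
have c0 : 0 < c by rewrite divr_gt0 ?mulr_gt0.
have EY a : \sum_x g x * Y a x = 0.
  under eq_bigr do rewrite mulrBr; rewrite sumrB -mulr_suml gP.2 mul1r.
  rewrite (bigD1 a) //= eqxx mulr1 big1 ?addr0 ?subrr // => x /negbTE ->.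
  by rewrite mulr0.
have Y1 a x : `|Y a x| <= 1.
  have := pmf_le1 gP a; have := gP.1 a; rewrite /Y ler_norml.
  by case: eqP => _ /= *; apply/andP; split; lra.
have sumY v a : size v = n -> \sum_(x <- v) Y a x = n%:R * (empirical v a - g a).
  move=> vn; rewrite sumrB big_const_seq count_predT iter_addr_0 vn ffunE vn.
  rewrite mulrBr mulrCA divff ?gt_eqF // mulr1 -[g a *+ n]mulr_natl; congr (_ - _).
  by rewrite -sum1_count natr_sum [RHS]big_mkcond; apply: eq_bigr => x _ /=; case: eqP.
apply: (@le_trans _ _ (\sum_a Ex g n (fun v => c ^- 4 * (\sum_(x <- v) Y a x) ^+ 4))).
  rewrite -Ex_sum; apply: Ex_le => // v vn.
  have pos a : 0 <= c ^- 4 * (\sum_(x <- v) Y a x) ^+ 4.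
    by rewrite mulr_ge0 ?exprn_even_ge0 // invr_ge0 exprn_ge0 // ltW.
  case: ltP => [vg|_]; last by rewrite sumr_ge0.
  (* Pigeonhole: a total deviation above [eta] forces some letter above its equal share. *)
  have [a av] : exists a, eta / #|T|%:R < `|empirical v a - g a|.
    apply: contrapT => /forallNP h; move: vg; rewrite ltNge => /negP; apply.
    apply: (@le_trans _ _ (\sum_(a : T) eta / #|T|%:R)).
      by apply: ler_sum => a _; rewrite leNgt; apply/negP/h.
    by rewrite sumr_const -[eta / _ *+ _]mulr_natr divfK ?gt_eqF.
  rewrite (bigD1 a) //= -[1%:R]addr0 lerD ?sumr_ge0 //.
  rewrite mulrC ler_pdivlMr ?exprn_gt0 // mul1r sumY //.
  rewrite -[leRHS]ger0_norm ?exprn_even_ge0 // normrX.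
  rewrite ler_pXn2r ?nnegrE ?normr_ge0 ?(ltW c0) //.
  by rewrite normrM gtr0_norm // /c -mulrA ler_pM2l // ltW.
apply: (@le_trans _ _ (\sum_(a : T) c ^- 4 * (3 * n%:R ^+ 2))).
  apply: ler_sum => a _; rewrite ExZ ler_wpM2l ?Ex_sum_fourth //.
  by rewrite invr_ge0 exprn_ge0 // ltW.
rewrite sumr_const -[_ * (3 * _) *+ _]mulr_natr /fourth_moment_const /c.
rewrite le_eqVlt; apply/orP; left; apply/eqP; field.
by rewrite !gt_eqF.
Qed.

End Empirical.

(** * The test stops within 2N good observations *)

(** The strict inequality excludes that the maximum is merely the initial value [x0], which is 0 for
    [Sk]. *)
Lemma bigmax_seq_attained (R : realType) (I : eqType) (r : seq I) (x0 : R) F :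
  x0 < \big[Num.max/x0]_(i <- r) F i ->
  exists2 i, i \in r & F i = \big[Num.max/x0]_(i <- r) F i.
Proof.
elim: r => [|i r IH]; first by rewrite big_nil ltxx.
rewrite big_cons; case: (leP (F i)) => Fi x0lt.
  by have [j jr Fj] := IH x0lt; exists j; rewrite // inE jr orbT.
by exists i; rewrite // mem_head.
Qed.

Section NetworkTest.
Variables (R : realType) (J : nat) (A : 'I_J -> finType).
Local Notation Xt := {dffun forall j : 'I_J, A j}.
Implicit Types (w v : seq Xt) (k l t : nat).

(** Index 0 reads the same letter as index 1, so [w] has to be nonempty even for [i = 0]. *)
Lemma obs_cat w v i : (0 < size w)%N -> (i <= size w)%N -> obs (w ++ v) i = obs w i.
Proof. by move=> w0 iw; rewrite /obs map_cat nth_cat size_map; case: ltnP => //; lia. Qed.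

Lemma emp_cat w v l k : (0 < k <= size w)%N -> emp R (w ++ v) l k = emp R w l k.
Proof.
move=> kw; apply/ffunP => a; rewrite !ffunE; congr (_ / _).
by apply: eq_big_nat => i ik; rewrite obs_cat //; lia.
Qed.

Lemma size_window w l k : (0 < l <= k)%N -> (k <= size w)%N ->
  size (take (k.+1 - l) (drop l.-1 w)) = (k.+1 - l)%N.
Proof. by move=> lk kw; rewrite size_takel // size_drop; lia. Qed.

Lemma emp_empirical w l k : (0 < l <= k)%N -> (k <= size w)%N ->
  emp R w l k = empirical R (take (k.+1 - l) (drop l.-1 w)).
Proof.
move=> lk kw; have sz := size_window lk kw.
apply/ffunP => a; rewrite !ffunE sz; congr (_ / _).
rewrite -sum1_count natr_sum [RHS]big_mkcond.
rewrite (eq_bigr (fun x => (Some x == Some a)%:R)); last first.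
  by move=> x _ /=; rewrite [Some x == _]/eq_op /=; case: eqP.
rewrite -(big_map Some xpredT (fun o => (o == Some a)%:R)) (big_nth None).
rewrite size_map sz -{1}[l]add0n big_addn.
apply: eq_big_nat => i ik; rewrite map_take map_drop nth_take; last by lia.
by rewrite nth_drop /obs; congr (nth _ _ _ == _)%:R; lia.
Qed.

Variable q : forall j : 'I_J, {ffun A j -> R} -> R.
Variables (kappa cS : R) (cD : nat -> R) (fstar : nat -> {ffun Xt -> R}).
Variable f0 : forall j : 'I_J, {ffun A j -> R}.

Local Notation Wterm := (Wterm q kappa).
Local Notation Sk := (Sk q kappa).
Local Notation ik := (ik q kappa).
Local Notation nk := (nk q kappa).
Local Notation Dk := (Dk q kappa fstar).
Local Notation reset := (reset q kappa cS cD fstar).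
Local Notation tau := (tau q kappa cS cD fstar).
Local Notation stopI := (stopI q kappa cS cD fstar).

(** * Causality: the test at time k depends only on the first k observations *)

Section Prefix.
Variables (w v : seq Xt).

Lemma Wterm_cat k l : (0 < k <= size w)%N -> Wterm (w ++ v) k l = Wterm w k l.
Proof. by move=> kw; rewrite /Defs.Wterm emp_cat. Qed.

Lemma Sk_cat k t : (0 < k <= size w)%N -> Sk (w ++ v) k t = Sk w k t.
Proof. by move=> kw; apply: eq_bigr => l _; rewrite Wterm_cat. Qed.

Lemma ik_cat k t : (0 < k <= size w)%N -> ik (w ++ v) k t = ik w k t.
Proof.
move=> kw; rewrite /Defs.ik Sk_cat //; congr head.
by apply: eq_filter => l; rewrite Wterm_cat.
Qed.

Lemma nk_cat k t : (0 < k <= size w)%N -> nk (w ++ v) k t = nk w k t.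
Proof. by move=> kw; rewrite /Defs.nk ik_cat. Qed.

Lemma Dk_cat k t : (0 < k <= size w)%N -> Dk (w ++ v) k t = Dk w k t.
Proof. by move=> kw; rewrite /Defs.Dk ik_cat // nk_cat // emp_cat. Qed.

Lemma reset_cat k t : (0 < k <= size w)%N -> reset (w ++ v) k t = reset w k t.
Proof. by move=> kw; rewrite /Defs.reset Sk_cat // Dk_cat // nk_cat. Qed.

Lemma tau_cat k : (k <= size w)%N -> tau (w ++ v) k = tau w k.
Proof.
elim: k => //= k IH kw; rewrite {}IH; last exact: ltnW.
by case: k kw => //= k kw; rewrite reset_cat //=; apply: ltnW.
Qed.

Lemma stopI_cat k : (0 < k <= size w)%N -> stopI (w ++ v) k = stopI w k.
Proof.
move=> kw; have kw' : (k <= size w)%N by case/andP: kw.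
by rewrite /Defs.stopI /S_at tau_cat // Sk_cat // Dk_cat // nk_cat.
Qed.

End Prefix.

Lemma Wterm_empty w k : Wterm w k k.+1 = 0.
Proof. by rewrite /Defs.Wterm subnn mul0r. Qed.

Lemma Wterm_le_Sk w k t l : (t <= l < k.+2)%N -> Wterm w k l <= Sk w k t.
Proof. by move=> tlk; apply: le_bigmax_seq; rewrite ?mem_index_iota. Qed.

(** The term at [k.+1] is 0, so a positive maximum is attained on a nonempty window, and the default
    value of [head] does not occur. *)
Lemma ik_attained w k t : 0 < Sk w k t ->
  (t <= ik w k t <= k)%N /\ Wterm w k (ik w k t) = Sk w k t.
Proof.
move=> S0; have [l lr Wl] := bigmax_seq_attained S0.
have : ik w k t \in [seq l <- index_iota t k.+2 | Wterm w k l == Sk w k t].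
  have : l \in [seq l <- index_iota t k.+2 | Wterm w k l == Sk w k t].
    by rewrite mem_filter lr andbT; apply/eqP.
  by rewrite /Defs.ik; case: [seq _ <- _ | _] => //= *; rewrite mem_head.
rewrite mem_filter mem_index_iota => /andP[/eqP Wi /andP[ti]].
rewrite ltnS leq_eqVlt => /orP[/eqP ik1|ik1]; last by rewrite ti.
by move: S0; rewrite -Wi ik1 Wterm_empty ltxx.
Qed.

Lemma tau_gt0 w k : (0 < tau w k)%N.
Proof. by elim: k => //= k IH; case: ifP. Qed.

(** The index starts at 1 because [tau w 0] is 1. *)
Lemma tau_le w k : (tau w k.+1 <= k.+1)%N.
Proof. by elim: k => //= k IH; case: ifP => // _; apply: leq_trans IH _. Qed.

Hypothesis cS_gt0 : 0 < cS.
Hypothesis fstarP : is_fstar q kappa cS f0 fstar.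

(* A threshold crossing makes the empirical pmf itself feasible, so that the
   minimizer [fstar] exists and is a pmf. *)
Lemma Dk_ge0 w k t : (0 < t)%N -> (k <= size w)%N -> cS <= Sk w k t ->
  (0 <= Dk w k t)%E.
Proof.
move=> t0 kw cSS; have [/andP[ti ik_le] Wi] := ik_attained (lt_le_trans cS_gt0 cSS).
have i0 : (0 < ik w k t <= k)%N by rewrite ik_le andbT (leq_trans t0).
have n0 : (0 < nk w k t)%N by rewrite /Defs.nk; lia.
have empP : is_pmf (emp R w (ik w k t) k).
  rewrite emp_empirical //; apply: empirical_pmf.
  by rewrite size_window.
have [|[fsP _] _] := fstarP n0; last exact: KL_ge0.
exists (emp R w (ik w k t) k); split=> //.
rewrite -lerBrDr ler_pdivrMr ?ltr0n // mulrC.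
by move: cSS; rewrite -Wi.
Qed.

Variable N : nat.
Hypothesis N_gt0 : (0 < N)%N.
Hypothesis cD0 : forall n, (0 < n <= N)%N -> cD n = 0.

Lemma nk_bounds w k t : 0 < Sk w k t -> (0 < nk w k t <= k.+1 - t)%N.
Proof. by move=> /ik_attained[? _]; rewrite /Defs.nk; lia. Qed.

(** A reset requires the divergence to lie strictly below the threshold, which is impossible for
    windows of at most [N] letters: there the threshold is 0. *)
Lemma reset_late w k t : (0 < t)%N -> (k <= size w)%N -> reset w k t ->
  (N < k.+1 - t)%N.
Proof.
move=> t0 kw /andP[cSS DcD]; rewrite ltnNge; apply/negP => ktN.
have nkP := nk_bounds (lt_le_trans cS_gt0 cSS).
have := Dk_ge0 t0 kw cSS; rewrite leNgt.
by rewrite cD0 in DcD; [rewrite DcD|lia].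
Qed.

(** By [reset_late], each reset protects the steps that follow it, up to the horizon [N]. *)
Lemma tau_stable w k i : (0 < k)%N -> (k + i <= size w)%N ->
  (k + i < tau w k + N)%N -> tau w (k + i) = tau w k.
Proof.
move=> k0; elim: i => [|i IH] iw iN; first by rewrite addn0.
have tau_i : tau w (k + i) = tau w k by apply: IH; lia.
rewrite addnS /= tau_i; case: ifP => // /andP[_ rst].
have := @reset_late w (k + i) (tau w k) (tau_gt0 _ _) ltac:(lia) rst.
by have := tau_gt0 w k; lia.
Qed.

(* If the first crossing after [w] is discarded, the test restarts on
   post-[w] data only; the next crossing then comes from at most [N]
   observations, where the divergence threshold vanishes. *)
Lemma stopI_within w v : size v = (N + N)%N ->
  (forall a, (a <= N)%N ->
    cS <= N%:R * (qtot q (empirical R (take N (drop a v))) - kappa)) ->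
  exists2 k, (size w < k <= size w + (N + N))%N & stopI (w ++ v) k.
Proof.
move=> vN good; set s := size w; set W := w ++ v.
have sW : size W = (s + (N + N))%N by rewrite size_cat vN.
have window l : (s < l <= s + N.+1)%N -> cS <= Wterm W (l + N.-1) l.
  move=> lP; rewrite /Defs.Wterm emp_empirical ?sW; [|lia..].
  have -> : ((l + N.-1).+1 - l = N)%N by lia.
  rewrite drop_cat -/s ifF; last by apply/negbTE; rewrite -leqNgt; lia.
  by apply: good; lia.
have tau_le1 := tau_le W (s + N).
have [st|nst] := boolP (stopI W (s + N)); first by exists (s + N)%N; rewrite //; lia.
(* If the last reset were no later than [s.+1], the first fresh window would be among the candidates
   at time [s + N]; that crossing must stop or reset, and it does not stop. *)
have tau_gt : (s.+1 < tau W (s + N).+1)%N.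
  rewrite /=; case: ifPn => [|nrst]; first by lia.
  rewrite ltnNge; apply: contra nst => tau_s.
  have cSS : cS <= Sk W (s + N) (tau W (s + N)).
    apply: le_trans (window s.+1 _) _; first by lia.
    have -> : (s.+1 + N.-1 = s + N)%N by lia.
    by apply: Wterm_le_Sk; lia.
  rewrite /Defs.stopI /S_at cSS /=.
  by move: nrst; rewrite /Defs.reset cSS /= addn_gt0 N_gt0 orbT /= -leNgt.
set t := tau W _ in tau_le1 tau_gt.
(* The strict bound [s.+1 < t] gives [t + N.-1 >= (s + N).+1], so this time is reached from
   [(s + N).+1] going forward, with no further reset. *)
have tau_t : tau W (t + N.-1) = t.
  have -> : (t + N.-1 = (s + N).+1 + (t + N.-1 - (s + N).+1))%N by lia.
  by rewrite tau_stable // -/t; lia.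
exists (t + N.-1)%N; first by lia.
have cSS : cS <= Sk W (t + N.-1) t.
  by apply: le_trans (window t _) (Wterm_le_Sk _ _); lia.
(* The maximizing window starts no earlier than [t], hence has at most [N] letters and threshold
   0. *)
rewrite /Defs.stopI /S_at tau_t cSS /= cD0.
  by apply: Dk_ge0; rewrite ?sW //; lia.
by have := nk_bounds (lt_le_trans cS_gt0 cSS); lia.
Qed.

End NetworkTest.

(** * From survival probabilities to the mean delay *)

Section Delay.
Variables (R : realType) (J : nat) (A : 'I_J -> finType).
Local Notation Xt := {dffun forall j : 'I_J, A j}.
Variables (g : {ffun Xt -> R}) (st : seq Xt -> nat -> bool).
Hypothesis gP : is_pmf g.

Definition nostop (w : seq Xt) (n : nat) : bool :=
  [forall k : 'I_n.+1, (0 < val k)%N ==> ~~ st w k].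

Lemma nostopP w n :
  reflect (forall k, (0 < k <= n)%N -> ~~ st w k) (nostop w n).
Proof.
apply: (iffP forallP) => [h k /andP[k0 kn]|h k].
  by have /implyP := h (Ordinal (kn : (k < n.+1)%N)); exact.
by apply/implyP => k0; apply: h; rewrite k0 -ltnS /=.
Qed.

Lemma Pnostop_Ex u m :
  Pnostop g st u m = Ex g m (fun v => (nostop (u ++ v) (size u + m))%:R).
Proof.
apply: eq_bigr => v _; congr (_ * _).
by rewrite big_tuple.
Qed.

Lemma Pnostop_ge0 u m : 0 <= Pnostop g st u m.
Proof.
by rewrite Pnostop_Ex -(Ex_cst gP m 0); apply: Ex_le => // v _; exact: ler0n.
Qed.

Lemma Pnostop_le1 u m : Pnostop g st u m <= 1.
Proof.
by rewrite Pnostop_Ex -[leRHS](Ex_cst gP m); apply: Ex_le => // v _; case: nostop.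
Qed.

Variables (M : nat) (p : R) (bad : pred (seq Xt)).
Hypothesis st_cat : forall w v k, (0 < k <= size w)%N -> st (w ++ v) k = st w k.
Hypothesis st_within : forall w v, size v = M -> ~~ bad v ->
  exists2 k, (size w < k <= size w + M)%N & st (w ++ v) k.
Hypothesis bad_le : Ex g M (fun v => (bad v)%:R) <= p.

(* Uniformity in the history [w] in [st_within] is what lets the survival
   probabilities decay geometrically along blocks of length [M]. *)
Lemma Pnostop_step u m : Pnostop g st u (m + M) <= p * Pnostop g st u m.
Proof.
rewrite !Pnostop_Ex Ex_cat -ExZ; apply: Ex_le => // v1 v1m.
rewrite mulrC; apply: le_trans (ler_wpM2l (ler0n _ _) bad_le).
rewrite -ExZ; apply: Ex_le => // v2 v2M.
rewrite -natrM ler_nat mulnb.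
case: nostopP => // ns.
have -> : nostop (u ++ v1) (size u + m).
  apply/nostopP => k kP; rewrite -(st_cat v2) ?size_cat ?v1m // -catA.
  by apply: ns; lia.
rewrite lt0b andTb; apply: contrapT => /negP nb.
have [k kP] := st_within (u ++ v1) v2M nb.
rewrite -catA; apply/negP/ns; move: kP; rewrite size_cat v1m; lia.
Qed.

(** Shifting the index by [M] bounds each partial sum by [M] plus [p] times itself. Finite partial
    sums allow the second term to be moved to the left before the limit is taken. *)
Lemma cdelay_le u : p < 1 -> (cdelay g st u <= (M%:R / (1 - p))%:E)%E.
Proof.
move=> p1; have P0 := Pnostop_ge0 u.
apply: lime_le; first by apply: is_cvg_nneseries => n _ _; rewrite lee_fin.
apply: nearW => n; rewrite sumEFin lee_fin ler_pdivlMr ?subr_gt0 //.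
rewrite big_mkord mulrBr mulr1 lerBlDr.
have shift : \sum_(i < n) Pnostop g st u i <=
    \sum_(i < M) Pnostop g st u i + \sum_(i < n) Pnostop g st u (i + M).
  have -> : \sum_(i < M) Pnostop g st u i + \sum_(i < n) Pnostop g st u (i + M)
      = \sum_(i < n + M) Pnostop g st u i.
    rewrite addnC big_split_ord /=; congr (_ + _).
    by apply: eq_bigr => i _; rewrite addnC.
  by rewrite big_split_ord /= lerDl sumr_ge0.
apply: le_trans shift _; apply: lerD.
  rewrite -[M in leRHS]card_ord -sum1_card natr_sum.
  by apply: ler_sum => i _; exact: Pnostop_le1.
by rewrite mulrC mulr_sumr; apply: ler_sum => i _; exact: Pnostop_step.
Qed.

End Delay.

(** * Union bound over the windows of a block *)

Lemma size_take_drop (X : Type) (v : seq X) n a :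
  size v = (n + n)%N -> (a <= n)%N -> size (take n (drop a v)) = n.
Proof. by move=> vn an; rewrite size_takel // size_drop vn; lia. Qed.

Section Windows.
Variables (R : realType) (T : finType) (g : {ffun T -> R}).
Hypothesis gP : is_pmf g.

(** The letters before and after the window integrate out. *)
Lemma Ex_window a n b F :
  Ex g (a + (n + b)) (fun v => F (take n (drop a v))) = Ex g n F.
Proof.
rewrite Ex_cat -[RHS](Ex_cst gP a); apply: eq_Ex => u ua.
rewrite Ex_cat; apply: eq_Ex => v vn.
rewrite -[RHS](Ex_cst gP b); apply: eq_Ex => w _.
by rewrite drop_size_cat // take_size_cat.
Qed.

Definition bad_window (eta : R) n (v : seq T) : bool :=
  [exists a : 'I_n.+1, eta < l1dist (empirical R (take n (drop a v))) g].

(** There are n + 1 <= 2n windows, each failing with probability O(1/n^2). *)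
Lemma Ex_bad_window (eta : R) n : 0 < eta -> (0 < n)%N ->
  Ex g (n + n) (fun v => (bad_window eta n v)%:R)
    <= 2 * fourth_moment_const T eta / n%:R.
Proof.
move=> eta0 n0; have nR : 0 < n%:R :> R by rewrite ltr0n.
have K0 : 0 <= fourth_moment_const T eta.
  exact: fourth_moment_const_ge0.
pose F v : R := (eta < l1dist (empirical R v) g)%R%:R.
apply: (@le_trans _ _ (\sum_(a < n.+1) Ex g (n + n) (fun v => F (take n (drop a v))))).
  rewrite -Ex_sum; apply: Ex_le => // v _; rewrite /bad_window.
  case: existsP => [[a av]|_]; last by rewrite sumr_ge0 // => a _; exact: ler0n.
  by rewrite (bigD1 a) //= {1}/F av lerDl sumr_ge0 // => b _; exact: ler0n.
apply: (@le_trans _ _ (\sum_(a < n.+1) fourth_moment_const T eta / n%:R ^+ 2)).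
  apply: ler_sum => a _.
  have -> : (n + n = a + (n + (n - a)))%N by have := ltn_ord a; lia.
  by rewrite Ex_window; exact: Ex_l1dist_empirical.
rewrite sumr_const card_ord -[_ *+ _]mulr_natr.
have -> : 2 * fourth_moment_const T eta / n%:R =
    fourth_moment_const T eta / n%:R ^+ 2 * (2 * n%:R) by field; rewrite gt_eqF.
apply: ler_wpM2l; first by rewrite divr_ge0 // exprn_ge0.
have : 1 <= n%:R :> R by rewrite ler1n.
by rewrite -natr1; lra.
Qed.

End Windows.

(** * Post-change drift and choice of the constants *)

Lemma qbarP (R : realType) (J : nat) (qlow : 'I_J -> R) (kappa : R) :
  (0 < J)%N -> (forall j, kappa < qlow j) ->
  0 < qbar qlow kappa /\ forall j, qbar qlow kappa + kappa <= qlow j.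
Proof.
move=> J0 klow; rewrite /qbar; set m := \big[_/_]_j _.
have mle j : (m <= (qlow j)%:E)%E by exact: bigmin_le.
have mgt : (kappa%:E < m)%E.
  by apply: lt_bigmin => [|j _]; rewrite ?ltry // lte_fin.
(* An empty minimum would be [+oo]; one sensor suffices for an upper bound. *)
have mfin : m \is a fin_num.
  rewrite fin_numElt (lt_trans (ltNyr kappa) mgt) /=.
  exact: le_lt_trans (mle (Ordinal J0)) (ltry _).
by split=> [|j]; rewrite ?subr_gt0 ?subrK -?lte_fin -?lee_fin fineK.
Qed.

(** One affected sensor contributes at least [c]; other affected sensors contribute positively and
    unaffected ones 0. *)
Lemma qtot_postpmf_ge (R : realType) (J : nat) (A : 'I_J -> finType)
  (q : forall j : 'I_J, {ffun A j -> R} -> R) (qlow : 'I_J -> R)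
  (f0 f1 : forall j : 'I_J, {ffun A j -> R}) (JJ : {set 'I_J}) (c : R) :
  (forall j, is_pmf (f0 j)) -> (forall j, q j (f0 j) = 0) ->
  (forall j, 0 < qlow j) -> (forall j, c <= qlow j) ->
  JJ != finset.set0 -> (forall j, j \in JJ -> is_pmf (f1 j) /\ qlow j <= q j (f1 j)) ->
  is_pmf (postpmf f0 f1 JJ) /\ c <= qtot q (postpmf f0 f1 JJ).
Proof.
move=> f0P q0 low0 clow /set0Pn[j0 j0J] f1P.
have hP j : is_pmf (if j \in JJ then f1 j else f0 j).
  by case: ifP => // /f1P[].
split; first exact: prodpmf_pmf.
rewrite /qtot (eq_bigr (fun j => q j (if j \in JJ then f1 j else f0 j))); last first.
  by move=> j _; rewrite (marg_prodpmf j hP).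
rewrite (bigD1 j0) //= j0J -[c]addr0 lerD //.
  exact: le_trans (clow j0) (f1P j0 j0J).2.
apply: sumr_ge0 => j _; case: ifP => [/f1P[_]|_]; last by rewrite q0.
by apply: le_trans; exact: ltW.
Qed.

Unset Implicit Arguments.

Theorem theorem2 (R : realType) (J : nat) (A : 'I_J -> finType)
  (f0 : forall j : 'I_J, {ffun A j -> R})
  (q : forall j : 'I_J, {ffun A j -> R} -> R) (L : 'I_J -> R) (qlow : 'I_J -> R)
  (kappa : R) :
  (0 < J)%N ->
  (forall j, is_pmf (f0 j)) ->
  (forall j, concave_on_simplex (q j)) ->
  (forall j, lipschitz_on_simplex (q j) (L j)) ->
  (forall j, q j (f0 j) = 0) ->
  (forall j, 0 < qlow j) ->
  0 < kappa -> (forall j, kappa < qlow j) ->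
  forall eps : R, 0 < eps ->
  exists rho0 : R, 0 < rho0 /\
  forall rho : R, 0 < rho -> rho < rho0 ->
  exists C0 : R, forall cS : R, C0 <= cS ->
  forall (cD : nat -> R) (fstar : nat -> {ffun {dffun forall j : 'I_J, A j} -> R}),
    (forall n : nat, (0 < n)%N -> 0 <= cD n) ->
    (forall n : nat, (0 < n)%N -> n%:R <= (1 + rho) * cS / qbar qlow kappa -> cD n = 0) ->
    is_fstar q kappa cS f0 fstar ->
    (WADD q qlow f0 (stopI q kappa cS cD fstar)
      <= ((1 + eps) * (2 * cS / qbar qlow kappa))%:E)%E.
Proof.
move=> J0 f0P _ qL q0 low0 _ klow eps eps0.
have [] := qbarP J0 klow; set qb := qbar qlow kappa => qb0 qble.
(* Half of [eps] pays for the window length [(1 + rho) * x], the other half for the factor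
   [1 / (1 - p)]. *)
exists (eps / 2); split=> [|rho rho0 rho_eps]; first by rewrite divr_gt0.
pose Lam := \sum_j `|L j|.
have Lam0 : 0 <= Lam by rewrite sumr_ge0.
(* Chosen so that the Lipschitz error costs at most [qb * rho / (2 + rho)], which leaves the drift
   [qb / (1 + rho / 2)]; [1 + Lam] avoids dividing by 0. *)
pose eta := qb * rho / ((2 + rho) * (1 + Lam)).
have eta0 : 0 < eta by rewrite divr_gt0 ?mulr_gt0 //; lra.
pose K := fourth_moment_const {dffun forall j, A j} eta.
have K0 : 0 <= K by exact: fourth_moment_const_ge0.
pose p := eps / (2 * (1 + eps)).
have p0 : 0 < p by rewrite divr_gt0 ?mulr_gt0 // addr_gt0.
have p1 : p < 1 by rewrite ltr_pdivrMr; lra.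
have pE : (1 + eps) * (1 - p) = 1 + eps / 2 by rewrite /p; field; lra.
(* The term [2 / rho] absorbs the rounding of [N], the term [2 * K / p] brings the bad event below
   [p], and the 1 makes [cS] positive. None depends on the post-change pmf or the past. *)
exists (1 + qb * (2 / rho + 2 * K / p)) => cS cSC cD fstar _ cD0 fstarP.
have rho20 : 0 < 2 / rho by rewrite divr_gt0.
have Kp0 : 0 <= 2 * K / p by exact: divr_ge0 (mulr_ge0 (ler0n _ 2) K0) (ltW p0).
have cS0 : 0 < cS.
  have := mulr_ge0 (ltW qb0) (addr_ge0 (ltW rho20) Kp0); lra.
pose x := cS / qb.
have x_ge : 2 / rho + 2 * K / p <= x.
  by rewrite ler_pdivlMr // mulrC; apply: le_trans cSC; rewrite lerDr.
have x_rho : 2 / rho <= x by lra.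
have x_K : 2 * K / p <= x by lra.
have rho_x : 2 <= x * rho by rewrite -ler_pdivrMr.
have x0 : 0 < x by rewrite divr_gt0.
have [N /andP[NleX XltN]] : exists N, N%:R <= (1 + rho) * x < N.+1%:R.
  exists (Num.truncn ((1 + rho) * x)); apply: truncn_itv.
  by rewrite mulr_ge0 ?ltW // addr_gt0.
(* Rounding loses less than 1, and [x * rho / 2] is at least 1. *)
have N_ge : (1 + rho / 2) * x <= N%:R by move: XltN; rewrite -natr1; lra.
have xN : x <= N%:R by apply: le_trans N_ge; rewrite mulrDl mul1r lerDl; nra.
have N0 : (0 < N)%N by rewrite -(ltr0n R); exact: lt_le_trans xN.
apply: ub_ereal_sup => _ [f1 [JJ [u [JJ0 f1P _ ->]]]].
have [gP qg] := qtot_postpmf_ge f0P q0 low0 qble JJ0 f1P.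
set g := postpmf f0 f1 JJ in gP qg *.
have bad_le : Ex g (N + N) (fun v => (bad_window g eta N v)%:R) <= p.
  apply: le_trans (Ex_bad_window gP eta0 N0) _.
  rewrite ler_pdivrMr ?ltr0n // [p * _]mulrC -ler_pdivrMr //.
  exact: le_trans x_K xN.
have good v : size v = (N + N)%N -> ~~ bad_window g eta N v ->
    forall a, (a <= N)%N ->
    cS <= N%:R * (qtot q (empirical R (take N (drop a v))) - kappa).
  move=> vN nb a aN.
  have eP : is_pmf (empirical R (take N (drop a v))).
    by apply: empirical_pmf; rewrite (size_take_drop vN aN).
  have := qtot_lipschitz qL eP gP; rewrite -/Lam.
  have : l1dist (empirical R (take N (drop a v))) g <= eta.
    rewrite leNgt; apply: contra nb => ag.
    by apply/existsP; exists (Ordinal (aN : (a < N.+1)%N)).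
  set d := l1dist _ _ => d_eta; rewrite ler_norml => /andP[qd _].
  have Ld : Lam * d <= qb * rho / (2 + rho).
    apply: (@le_trans _ _ (Lam * eta)); first by rewrite ler_wpM2l.
    have -> : qb * rho / (2 + rho) = (1 + Lam) * eta.
      by rewrite /eta; field; rewrite !gt_eqF //; lra.
    by rewrite ler_wpM2r ?ltW //; lra.
  (* The lower bound on [N] times the remaining drift is exactly [cS]. *)
  have -> : cS = (1 + rho / 2) * x * (2 * qb / (2 + rho)).
    by rewrite /x; field; rewrite !gt_eqF //; lra.
  have q20 : 0 <= 2 * qb / (2 + rho) by rewrite divr_ge0 ?mulr_ge0 //; lra.
  apply: (@le_trans _ _ (N%:R * (2 * qb / (2 + rho)))); first by rewrite ler_wpM2r.
  rewrite ler_wpM2l //.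
  have -> : 2 * qb / (2 + rho) = qb - qb * rho / (2 + rho) by field; lra.
  lra.
apply: le_trans (cdelay_le gP _ _ bad_le _ p1) _.
- by move=> w v k kw; exact: stopI_cat.
- move=> w v vN nb; apply: (stopI_within cS0 fstarP N0) => //; last exact: good.
  move=> n /andP[n0 nN]; apply: cD0 => //; rewrite -mulrA.
  by apply: le_trans NleX; rewrite ler_nat.
(* With [(1 + eps) * (1 - p) = 1 + eps / 2], what remains is [N <= (1 + eps / 2) * x], which follows
   from [rho < eps / 2]. *)
rewrite lee_fin ler_pdivrMr ?subr_gt0 // mulrAC pE -mulrA -/x natrD.
have : (1 + rho) * x <= (1 + eps / 2) * x by rewrite ler_pM2r //; lra.
lra.
Qed.
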